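(* Let $\psi_0$ be an admissible scalar penalty, let $\lambda_1\ge\dots\ge\lambda_p\ge0$ with at least one strict inequality, and let $\mathbf{y}\in\mathcal{K}_p^+$. Assume that for every block $B=\{q,\dots,r\}\subset\{1,\dots,p\}$ and every sub-block $B_1=\{q,\dots,r'\}$ with $r'\le r$, $$\rho^+\big(T(\bar\lambda_B);\bar\lambda_B\big)\ \ge\ m(\bar\lambda_{B_1}).$$ Let $i^\star$ be the largest index $i\in\{1,\dots,p\}$ for which there exists $\mathbf{u}\in\mathcal{L}_{i-1}$ such that $(\mathbf{u},c,\dots,c)$ is feasible, i.e. belongs to $\mathcal{K}_p^+$, where $c=\chi(\{i,\dots,p\})$ is repeated $p-i+1$ times. If $\mathbf{x}$ is a global minimizer of $(P_p)$, then either - $\mathbf{x}=(\mathbf{u},\chi(\{i^\star,\dots,p\}),\dots,\chi(\{i^\star,\dots,p\}))$ for some $\mathbf{u}\in\mathcal{L}_{i^\star-1}$, or - $\mathbf{x}=(\mathbf{u},0,\dots,0)$ for some $i\in\{1,\dots,p\}$ and some $\mathbf{u}\in\mathcal{L}_{i-1}$ (with $p-i+1$ trailing zeros).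
   Context: $\mathcal{K}_k^+=\{\mathbf{x}\in\mathbb{R}^k: x_1\ge\dots\ge x_k\ge0\}$. For $k\in\{1,\dots,p\}$, $(P_k)$ is the problem of minimizing $\frac12\sum_{i=1}^k(x_i-y_i)^2+\sum_{i=1}^k\lambda_i\psi_0(x_i)$ over $\mathbf{x}\in\mathcal{K}_k^+$, and $\mathcal{L}_k$ is the set of its local minimizers (relative to $\mathcal{K}_k^+$); $\mathcal{L}_0$ consists of the empty vector. Admissible scalar penalty: $\psi_0:[0,\infty)\to[0,\infty)$ is continuous, non-decreasing and concave, $\psi_0(0)=0$; $\psi_0$ is continuously differentiable on $(0,\infty)$ and $\psi_0'(0):=\lim_{z\to0^+}\psi_0'(z)\in[0,\infty]$; $\psi_0$ is twice differentiable on $(0,\infty)$ except possibly on a finite set $Z_\psi$; the second derivative $\psi_0''$ is increasing, and $\lim_{z\to+\infty}\psi_0''(z)=0$. For $\lambda>0$: $m(\lambda)=\inf\{z\in(0,\infty)\setminus Z_\psi:\psi_0''(z)\ge-1/\lambda\}$ (the function $z\mapsto\frac12(z-y)^2+\lambda\psi_0(z)$ is strictly concave on $[0,m(\lambda)]$ and convex on $[m(\lambda),\infty)$) and $\tau(\lambda)=m(\lambda)+\lambda\psi_0'(m(\lambda))$. For $y\ge\tau(\lambda)$, $\rho^+(y;\lambda)$ is the minimizer of $z\mapsto\frac12(z-y)^2+\lambda\psi_0(z)$ over the convex region $[m(\lambda),\infty)$. $T(\lambda)\ge\tau(\lambda)$ is the threshold such that $z\mapsto\frac12(z-y)^2+\lambda\psi_0(z)$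 on $[0,\infty)$ has global minimizer $0$ if $y<T(\lambda)$, global minimizers $0$ and $\rho^+(y;\lambda)$ if $y=T(\lambda)$, and global minimizer $\rho^+(y;\lambda)$ if $y>T(\lambda)$. At $\lambda=0$ these are read as $m(0)=\tau(0)=T(0)=0$. A block is a non-empty set $B$ of consecutive indices of $\{1,\dots,p\}$; $\bar y_B=\frac1{|B|}\sum_{i\in B}y_i$, $\bar\lambda_B=\frac1{|B|}\sum_{i\in B}\lambda_i$; $\chi(B)=\rho^+(\bar y_B;\bar\lambda_B)$ if $\bar y_B\ge\tau(\bar\lambda_B)$, and $\chi(B)=0$ otherwise. *)

(* Defs.v *)
From HB Require Import structures.
From mathcomp Require Import all_boot all_order all_algebra.
From mathcomp Require Import all_classical all_reals all_analysis.

Set Implicit Arguments.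
Unset Strict Implicit.
Unset Printing Implicit Defensive.

Import Order.TTheory GRing.Theory Num.Theory.
Import numFieldNormedType.Exports.

Local Open Scope classical_set_scope.
Local Open Scope ring_scope.

Definition minimizers (R : realType) (E : Type) (A : set E) (f : E -> R) : set E :=
  [set x | A x /\ forall w, A w -> f x <= f w].

(* Local minimality is relative to A. *)
Definition local_minimizers (R : realType) (E : topologicalType) (A : set E)
    (f : E -> R) : set E :=
  [set x | A x /\ \forall w \near within A (nbhs x), f x <= f w].

(* A function on [0, +oo[ is represented by a total function R -> R; its values
   on negative reals are never used.  Z is the finite set outside of which psi
   is twice differentiable.  "Increasing" for the second derivative is
   non-strict: it is piecewise constant for MCP. *)
Record admissible_penalty (R : realType) (psi : R -> R) (Z : set R) : Prop := {
  penalty_ge0 : forall z : R, 0 <= z -> 0 <= psi z;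
  penalty0 : psi 0 = 0;
  penalty_continuous : {within `[0, +oo[, continuous psi};
  penalty_nondecreasing : forall z w : R, 0 <= z -> z <= w -> psi z <= psi w;
  penalty_concave : @convex_function R R^o `[0, +oo[ (\- psi);
  penalty_derivable : forall z : R, 0 < z -> derivable psi z 1;
  penalty_derive_continuous : forall z : R, 0 < z -> {for z, continuous psi^`()%classic};
  penalty_derive_at0 : exists2 l : \bar R, (0 <= l)%E &
    (psi^`()%classic z)%:E @[z --> 0^'+] --> l;
  penalty_finite : finite_set Z;
  penalty_derivable2 : forall z : R, 0 < z -> ~ Z z -> derivable psi^`()%classic z 1;
  penalty_derive2_nondecreasing : forall z w : R, 0 < z -> z <= w ->
    ~ Z z -> ~ Z w -> psi^`(2)%classic z <= psi^`(2)%classic w;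
  penalty_derive2_at_infty : psi^`(2)%classic z @[z --> +oo] --> (0 : R)
}.

(* The derivative on [0, +oo[; it may be +oo at 0. *)
Definition penalty_deriv (R : realType) (psi : R -> R) (z : R) : \bar R :=
  if z == 0 then lim ((psi^`()%classic t)%:E @[t --> 0^'+]) else (psi^`()%classic z)%:E.

(* The point m(lam): z |-> (z - y)^2/2 + lam psi(z) is strictly concave on
   [0, m(lam)] and convex on [m(lam), +oo[. *)
Definition inflection (R : realType) (psi : R -> R) (Z : set R) (lam : R) : R :=
  if lam == 0 then 0
  else inf [set z | [/\ 0 < z, ~ Z z & - lam^-1 <= psi^`(2)%classic z]].

Definition tau (R : realType) (psi : R -> R) (Z : set R) (lam : R) : \bar R :=
  if lam == 0 then 0%E
  else ((inflection psi Z lam)%:E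
        + lam%:E * penalty_deriv psi (inflection psi Z lam))%E.

Definition scalar_objective (R : realType) (psi : R -> R) (y lam z : R) : R :=
  2^-1 * (z - y) ^+ 2 + lam * psi z.

(* Fails if psi'' = -1/lam on an interval starting at m(lam), since the minimizer
   is then not unique for y = tau(lam); it is therefore a property of lam. *)
Definition is_rho_plus (R : realType) (psi : R -> R) (Z : set R) (lam : R)
    (rho : R -> R) : Prop :=
  forall y, (tau psi Z lam <= y%:E)%E ->
    minimizers `[inflection psi Z lam, +oo[ (scalar_objective psi y lam)
    = [set rho y].

(* For lam = 0 this forces T = 0. *)
Definition is_threshold (R : realType) (psi : R -> R) (Z : set R) (lam : R)
    (rho : R -> R) (T : R) : Prop :=
  (tau psi Z lam <= T%:E)%E /\
  forall y,
    [/\ y < T ->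
          minimizers `[0, +oo[ (scalar_objective psi y lam) = [set 0],
        y = T ->
          minimizers `[0, +oo[ (scalar_objective psi y lam) = [set 0; rho y]
      & T < y ->
          minimizers `[0, +oo[ (scalar_objective psi y lam) = [set rho y]].

Definition monotone_cone (R : realType) (k : nat) : set 'rV[R]_k :=
  [set x | (forall i j : 'I_k, (i <= j)%N -> x 0 j <= x 0 i) /\
           (forall i : 'I_k, 0 <= x 0 i)].

Definition objective (R : realType) (psi : R -> R) (k : nat)
    (lam y x : 'rV[R]_k) : R :=
  2^-1 * (\sum_(i < k) (x 0 i - y 0 i) ^+ 2) + \sum_(i < k) lam 0 i * psi (x 0 i).

(* Indices are 0-based: i : 'I_p stands for the index i + 1, so that the entries
   strictly before it form a vector of length i. *)
Definition before (R : realType) (p : nat) (i : 'I_p) (v : 'rV[R]_p) : 'rV[R]_i :=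
  \row_(j < i) v 0 (widen_ord (ltnW (ltn_ord i)) j).

Definition local_solutions_before (R : realType) (psi : R -> R) (p : nat)
    (lam y : 'rV[R]_p) (i : 'I_p) : set 'rV[R]_i :=
  local_minimizers (@monotone_cone R i)
    (objective psi (before i lam) (before i y)).

(* The vector (u, c, ..., c) of length p. *)
Definition pad (R : realType) (p k : nat) (u : 'rV[R]_k) (c : R) : 'rV[R]_p :=
  \row_(j < p) (if insub (val j) is Some j' then u 0 (j' : 'I_k) else c).

Definition block (p q r : nat) : {set 'I_p} :=
  [set j : 'I_p | (q <= j <= r)%N]%SET.

Definition mean (R : realType) (p : nat) (v : 'rV[R]_p) (B : {set 'I_p}) : R :=
  (#|B|%:R)^-1 * \sum_(j in B) v 0 j.

Definition chi (R : realType) (psi : R -> R) (Z : set R) (rho : R -> R -> R)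
    (p : nat) (lam y : 'rV[R]_p) (B : {set 'I_p}) : R :=
  if (tau psi Z (mean lam B) <= (mean y B)%:E)%E
  then rho (mean y B) (mean lam B) else 0.

(* block p i p.-1 is the set of indices from i to the last one. *)
Definition feasible_start (R : realType) (psi : R -> R) (Z : set R)
    (rho : R -> R -> R) (p : nat) (lam y : 'rV[R]_p) (i : 'I_p) : Prop :=
  exists2 u : 'rV[R]_i, local_solutions_before psi lam y u &
    @monotone_cone R p (pad p u (chi psi Z rho lam y (block p i p.-1))).

(* Main.v *)
Require Import Defs.
From HB Require Import structures.
From mathcomp Require Import all_boot all_order all_algebra.
From mathcomp Require Import all_classical all_reals all_analysis.
From mathcomp Require Import ring lra.

Set Implicit Arguments.
Unset Strict Implicit.
Unset Printing Implicit Defensive.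

Import Order.TTheory GRing.Theory Num.Theory.
Import numFieldNormedType.Exports.

Local Open Scope classical_set_scope.
Local Open Scope ring_scope.

(* Let c be the last value of the minimizer x and i the first index where it is taken.
   The part of x before i is a local solution, since its entries exceed c.  If c > 0,
   then c is an interior local minimizer of the averaged scalar problem of the block
   {i, ..., p}, hence c = chi, and comparing c with 0 gives ybar >= T; therefore c is at
   least rho(T), hence, by the assumption on one-element prefixes, at least m(lambda_i).
   Thus every scalar problem with weight at most lambda_i has an increasing derivative
   on [c, oo[, and this derivative is strictly increasing because rho is single-valued.
   Now i is admissible, so i <= istar.  If i < istar, let (u, d, ..., d) be feasible with
   u a local solution and d = chi({istar, ..., p}).  Lowering the end of x shows d >= c,
   so the entries of u are at least c; moving x towards u and u towards x then
   forces u = c on {i, ..., istar - 1}, so d = c, and the part of x before istar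
   inherits local minimality from x (upwards) and from u (downwards). *)

(** * One-variable calculus: monotonicity off a finite set, one-sided minima *)

(** Induction on the exceptional points: the interval is cut at one of them, and continuity there
    lets the two halves be chained. The Boolean [C] treats the strict and the non-strict version at
    once. *)
Lemma lteif_incr_off_finite (R : realType) (C : bool) (g : R -> R) (s : seq R) (a b : R) :
  a < b -> (forall z, a <= z <= b -> {for z, continuous g}) ->
  (forall z, a < z < b -> z \notin s -> derivable g z 1 /\ 0 < g^`()%classic z ?<= if C) ->
  g a < g b ?<= if C.
Proof.
elim: s a b => [|x s IH] a b ab gc dg.
  have cg : {within `[a, b], continuous g}.
    apply: continuous_in_subspaceT => z; rewrite inE/= in_itv/=; exact: gc.
  have ain : a \in `[a, b] by rewrite in_itv/= lexx ltW.
  have bin : b \in `[a, b] by rewrite in_itv/= lexx ltW.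
  case: C dg => dg /=.
    apply: (@ger0_derive1_le_cc _ g a b) => //; last exact: ltW.
    - by move=> z; rewrite in_itv/= => /dg[].
    - by move=> z; rewrite in_itv/= => /dg[].
  apply: (@gtr0_derive1_lt_cc _ g a b) => //.
  - by move=> z; rewrite in_itv/= => /dg[].
  - by move=> z; rewrite in_itv/= => /dg[].
have [/andP[ax xb]|xN] := boolP (a < x < b).
  have -> : C = C && C by rewrite andbb.
  apply: (@lteif_trans _ _ _ (g x)).
    apply: IH => // [z /andP[az zx]|z /andP[az zx] zs].
      by apply: gc; rewrite az (le_trans zx)// ltW.
    apply: dg; first by rewrite az (lt_trans zx).
    by rewrite inE negb_or zs (lt_eqF zx).
  apply: IH => // [z /andP[xz zb]|z /andP[xz zb] zs].
    by apply: gc; rewrite zb (le_trans _ xz)// ltW.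
  apply: dg; first by rewrite zb (lt_trans ax).
  by rewrite inE negb_or zs (gt_eqF xz).
apply: IH => // z zab zs; apply: dg => //; rewrite inE negb_or zs andbT.
by apply: contraNneq xN => <-.
Qed.

(** The derivative is computed as the limit of the right difference quotients, which are
    nonnegative. *)
Lemma derive_ge0_right_min (R : realType) (f : R -> R) (D d : R) :
  is_derive (0 : R) 1 f D -> 0 < d -> (forall t : R, 0 < t < d -> f 0 <= f t) -> 0 <= D.
Proof.
move=> fD d0 fmin; have df : derivable f 0 1 by exact: ex_derive.
rewrite -(derive_val (is_derive := fD)) ['D_1 f 0]cvg_at_rightE; last exact: df.
apply: limr_ge.
  have dfc := df.
  rewrite -(cvg_at_rightE (fun h : R => h^-1 *: ((f \o shift 0) _ - f 0)))//.
  apply: cvg_trans dfc; apply: cvg_app.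
  move=> A [e egt0 Ae]; exists e => // x xe xgt0; apply: Ae => //.
  exact/lt0r_neq0.
near=> h; apply: mulr_ge0.
  by rewrite invr_ge0 ltW.
rewrite subr_ge0 [_%:A]mulr1 /= addr0; apply: fmin.
by apply/andP; split.
Unshelve. all: end_near. Qed.

(** * The scalar problem: slopes, inflection point and [rho] *)

(** The derivative of [scalar_objective psi y l] is [slope psi l z - y]; with [y] left out,
    stationarity reads [slope psi l z = y]. *)
Definition slope (R : realType) (psi : R -> R) (l z : R) : R :=
  z + l * psi^`()%classic z.

Section scalar.
Context (R : realType) (psi : R -> R) (Z : set R).
Hypothesis psi_adm : admissible_penalty psi Z.

(** The second derivative tends to 0, above [- l^-1], and large points avoid the finite set [Z].
    Thus [inf] is a true infimum and not its default value. *)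
Lemma inflection_set_nonempty (l : R) : 0 < l ->
  [set z | [/\ 0 < z, ~ Z z & - l^-1 <= psi^`(2)%classic z]] !=set0.
Proof.
move=> l0; have /finite_seqP[s Zs] := penalty_finite psi_adm.
have h : \forall z \near +oo, - l^-1 <= psi^`(2)%classic z.
  apply: (cvgr_ge _ (penalty_derive2_at_infty psi_adm)).
  by rewrite oppr_lt0 invr_gt0.
have hs : \forall z \near +oo, z \notin s.
  elim: s {Zs} => [|x s IH]; first by apply: nearW.
  near=> z; rewrite inE negb_or; apply/andP; split; last by near: z.
  by rewrite gt_eqF//; near: z; apply: nbhs_pinfty_gt; rewrite num_real.
suff : \forall z \near +oo,
    [set z | [/\ 0 < z, ~ Z z & - l^-1 <= psi^`(2)%classic z]] z.
  by move=> /filter_ex.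
near=> z; split; [|rewrite Zs; apply/negP|]; near: z => //.
by apply: nbhs_pinfty_gt; rewrite num_real.
Unshelve. all: end_near. Qed.

Lemma inflection_has_inf (l : R) : 0 < l ->
  has_inf [set z | [/\ 0 < z, ~ Z z & - l^-1 <= psi^`(2)%classic z]].
Proof.
move=> l0; split; first exact: inflection_set_nonempty.
by exists 0 => z [/ltW].
Qed.

Lemma inflection_ge0 (l : R) : 0 <= l -> 0 <= inflection psi Z l.
Proof.
rewrite le_eqVlt /inflection => /predU1P[<-|l0]; first by rewrite eqxx.
rewrite gt_eqF//; apply: lb_le_inf; first exact: inflection_set_nonempty.
by move=> z [/ltW].
Qed.

(** A larger weight raises the bound [- l^-1], so the set under the infimum shrinks. *)
Lemma le_inflection (l l' : R) : 0 <= l -> l <= l' ->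
  inflection psi Z l <= inflection psi Z l'.
Proof.
rewrite le_eqVlt => /predU1P[<-|l0] ll'.
  by rewrite {1}/inflection eqxx inflection_ge0.
have l'0 := lt_le_trans l0 ll'.
rewrite /inflection !gt_eqF//; apply: inf_le.
- move=> _ [z [z0 Zz hz] <-]; apply: le_down; exists z => //; split => //.
  by apply: le_trans hz; rewrite lerN2 lef_pV2.
- exact: inflection_set_nonempty.
- exact: inflection_has_inf.
Qed.

Lemma is_derive_slope (l z : R) : 0 < z -> ~ Z z ->
  is_derive z 1 (slope psi l) (1 + l * psi^`(2)%classic z).
Proof.
move=> z0 Zz; have d2 := penalty_derivable2 psi_adm z0 Zz.
have -> : slope psi l = id + l *: psi^`()%classic by [].
apply: is_deriveD; apply: is_deriveZ.
exact: (DeriveDef d2 (esym (derive1E _ _))).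
Qed.

Lemma continuous_slope (l z : R) : 0 < z -> {for z, continuous (slope psi l)}.
Proof.
move=> z0; have c1 := penalty_derive_continuous psi_adm z0.
by apply: cvgD; [exact: cvg_id|apply: cvgZr].
Qed.

(** Past the inflection point some point of the defining set lies further left; since the second
    derivative is nondecreasing, [1 + l * psi''] is nonnegative. *)
Lemma slope_nondecreasing (l a b : R) : 0 <= l -> 0 < a ->
  inflection psi Z l <= a -> a <= b -> slope psi l a <= slope psi l b.
Proof.
move=> l0 a0 ma; rewrite le_eqVlt => /predU1P[->//|ab].
move: l0; rewrite le_eqVlt => /predU1P[<-|l0].
  by rewrite /slope !mul0r !addr0 ltW.
have /finite_seqP[s Zs] := penalty_finite psi_adm.
apply: (@lteif_incr_off_finite _ true (slope psi l) s) => //.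
  by move=> z /andP[az _]; apply: continuous_slope; exact: lt_le_trans az.
move=> z /andP[az zb] zs; have z0 := lt_trans a0 az.
have Zz : ~ Z z by rewrite Zs; apply/negP.
have dz := is_derive_slope l z0 Zz.
split; first exact: ex_derive.
rewrite derive1E derive_val /=.
have := le_lt_trans ma az; rewrite /inflection gt_eqF// => infz.
have [w [w0 Zw hw] wz] := inf_lt (inflection_set_nonempty l0) infz.
have := le_trans hw (penalty_derive2_nondecreasing psi_adm w0 (ltW wz) Zw Zz).
by rewrite -(ler_pM2l l0) mulrN divff ?gt_eqF// -subr_ge0 opprK addrC.
Qed.

(** A point outside [Z] with [psi'' >= - l^-1] would belong to the defining set, so none lies
    strictly below its infimum. *)
Lemma slope_decreasing (l a b : R) : 0 <= l -> 0 < a ->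
  a < b -> b <= inflection psi Z l -> slope psi l b < slope psi l a.
Proof.
move=> l0 a0 ab bm.
(* At [l = 0] the inflection point is 0 by convention, which leaves no room for [0 < a < b]. *)
have {}l0 : 0 < l.
  rewrite lt_neqAle l0 andbT; apply: contraTneq (lt_le_trans (lt_trans a0 ab) bm) => <-.
  by rewrite /inflection eqxx ltxx.
have /finite_seqP[s Zs] := penalty_finite psi_adm.
rewrite -ltrN2.
apply: (@lteif_incr_off_finite _ false (- slope psi l) s) => //.
  move=> z /andP[az _]; apply: continuousN; apply: continuous_slope.
  exact: lt_le_trans az.
move=> z /andP[az zb] zs; have z0 := lt_trans a0 az.
have Zz : ~ Z z by rewrite Zs; apply/negP.
have dz := is_derive_slope l z0 Zz.
split; first exact: ex_derive.
rewrite derive1E derive_val /= ltrNr oppr0 -ltrBrDl sub0r.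
rewrite -(ltr_pM2l (_ : 0 < l^-1)) ?invr_gt0// mulrA mulVf ?gt_eqF// mul1r mulrN1.
rewrite ltNge; apply/negP => hz.
move: bm; rewrite leNgt /inflection gt_eqF// => /negP; apply.
apply: le_lt_trans zb; apply: ge_inf; last by split.
by exists 0 => w [/ltW].
Qed.

Lemma is_derive_objective (y l z : R) : 0 < z ->
  is_derive z 1 (scalar_objective psi y l) (slope psi l z - y).
Proof.
move=> z0; have dpsi : is_derive z 1 psi (psi^`()%classic z).
  exact: (DeriveDef (penalty_derivable psi_adm z0) (esym (derive1E _ _))).
have -> : scalar_objective psi y l =
    2^-1 *: ((id - cst y) * (id - cst y)) + l *: psi.
  by apply/funext => w; rewrite /scalar_objective expr2.
have dB : is_derive z 1 (id - cst y) (1 - 0) := is_deriveB (is_derive_id z 1) (is_derive_cst y z 1).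
have dq := is_deriveM dB dB.
apply: (is_derive_eq (is_deriveD (is_deriveZ 2^-1 dq) (is_deriveZ l dpsi))).
change (2^-1 * ((z - y) * (1 - 0) + (z - y) * (1 - 0)) + l * psi^`()%classic z =
  z + l * psi^`()%classic z - y).
by field.
Qed.

Lemma continuous_objective (y l a b : R) : 0 <= a ->
  {within `[a, b], continuous (scalar_objective psi y l)}.
Proof.
move=> a0; have cpsi : {within `[a, b], continuous psi}.
  apply: continuous_subspaceW (penalty_continuous psi_adm) => z.
  by rewrite /= !in_itv/= => /andP[/(le_trans a0) ->].
have cq : {within `[a, b], continuous (fun z : R => 2^-1 * (z - y) ^+ 2)}.
  apply: continuous_subspaceT => z.
  apply: cvgMr; apply: (@continuous_comp _ _ _ (fun z => z - y) (fun z => z ^+ 2)).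
    by apply: cvgD; [exact: cvg_id|exact: cvg_cst].
  exact: exprn_continuous.
move=> z; apply: (@continuousD _ _ (subspace `[a, b]) _ _ z); first exact: cq.
by apply: continuousM; [exact: cvg_cst|exact: cpsi].
Qed.

Lemma objective_le_right (y l c w : R) : 0 <= l -> 0 < c ->
  inflection psi Z l <= c -> y <= slope psi l c -> c <= w ->
  scalar_objective psi y l c <= scalar_objective psi y l w.
Proof.
move=> l0 c0 mc yc cw.
have d z : z \in `]c, w[ -> is_derive z 1 (scalar_objective psi y l) (slope psi l z - y).
  by rewrite in_itv/= => /andP[cz _]; apply: is_derive_objective; exact: lt_trans cz.
have dv z : z \in `]c, w[ -> derivable (scalar_objective psi y l) z 1.
  by move=> /d dz; exact: ex_derive.
apply: (ger0_derive1_le_cc dv) (cw).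
- move=> z zcw; have dz := d z zcw; rewrite derive1E derive_val subr_ge0.
  move: zcw; rewrite in_itv/= => /andP[cz _].
  by rewrite (le_trans yc)// slope_nondecreasing// ltW.
- by apply: continuous_objective; exact: ltW.
- by rewrite bound_itvE.
- by rewrite bound_itvE.
Qed.

(** The derivative is at most 0 on []w, c[]. An inequality on the slope suffices, which is all that
    a tail that can only be lowered provides. *)
Lemma objective_le_left (y l c w : R) : 0 <= l -> 0 < c ->
  inflection psi Z l <= w -> slope psi l c <= y -> w <= c ->
  scalar_objective psi y l c <= scalar_objective psi y l w.
Proof.
move=> l0 c0 mw yc wc; have w0 := le_trans (inflection_ge0 l0) mw.
have d z : z \in `]w, c[ -> is_derive z 1 (scalar_objective psi y l) (slope psi l z - y).
  by rewrite in_itv/= => /andP[cz _]; apply: is_derive_objective; exact: le_lt_trans cz.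
have dv z : z \in `]w, c[ -> derivable (scalar_objective psi y l) z 1.
  by move=> /d dz; exact: ex_derive.
apply: (ler0_derive1_le_cc dv) (wc).
- move=> z zcw; have dz := d z zcw; rewrite derive1E derive_val subr_le0.
  move: zcw; rewrite in_itv/= => /andP[cz zc].
  rewrite (le_trans _ yc)// slope_nondecreasing//.
  + exact: le_lt_trans cz.
  + exact: le_trans mw (ltW cz).
  + exact: ltW.
- exact: continuous_objective.
- by rewrite bound_itvE.
- by rewrite bound_itvE.
Qed.

Lemma objective_stationary_min (y l c : R) : 0 <= l -> 0 < c ->
  inflection psi Z l <= c -> slope psi l c = y ->
  minimizers `[inflection psi Z l, +oo[ (scalar_objective psi y l) c.
Proof.
move=> l0 c0 mc cy; split => [|w]; first by rewrite /= in_itv/= mc.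
rewrite /= in_itv/= andbT => mw; have [cw|wc] := leP c w.
  by apply: objective_le_right; rewrite ?cy.
by apply: objective_le_left => //; rewrite ?cy// ltW.
Qed.

(** [tau] is the slope at the inflection point. If that point is 0, the slope there is a limit, a
    priori infinite, and the bound is obtained at small [t > 0] and passed to the limit. *)
Lemma tau_le_slope (l c : R) : 0 <= l -> 0 < c -> inflection psi Z l <= c ->
  (tau psi Z l <= (slope psi l c)%:E)%E.
Proof.
rewrite le_eqVlt => /predU1P[<-|l0] c0 mc.
  by rewrite /tau eqxx /slope mul0r addr0 lee_fin ltW.
rewrite /tau gt_eqF// /penalty_deriv.
case: eqVneq => [m0|m0]; last first.
  rewrite -EFinM -EFinD lee_fin -/(slope psi l _).
  by apply: slope_nondecreasing => //; rewrite ?ltW// lt_neqAle eq_sym m0 inflection_ge0// ltW.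
rewrite m0 add0e -lee_pdivlMl//.
have [L _ hL] := penalty_derive_at0 psi_adm.
rewrite (cvg_lim _ hL)// -EFinM.
apply: cvge_le hL.
near=> t; rewrite lee_fin ler_pdivlMl//.
have t0 : 0 < t by near: t; exact: nbhs_right_gt.
apply: (@le_trans _ _ (slope psi l t)); first by rewrite /slope lerDr ltW.
apply: slope_nondecreasing; rewrite ?m0 ?ltW//.
Unshelve. all: end_near. Qed.

(** A stationary point of the convex region is a minimizer, and [is_rho_plus] allows only one; so
    [rho] inverts the slope. *)
Lemma rho_slope (l : R) (rho : R -> R) (c : R) : is_rho_plus psi Z l rho ->
  0 <= l -> 0 < c -> inflection psi Z l <= c -> rho (slope psi l c) = c.
Proof.
move=> rhoP l0 c0 mc.
have := objective_stationary_min l0 c0 mc erefl.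
by rewrite rhoP => [/esym//|]; exact: tau_le_slope.
Qed.

(** If the slopes at [a] and [b] were equal, [rho] would send their common value to both points. *)
Lemma slope_increasing (l : R) (rho : R -> R) (a b : R) : is_rho_plus psi Z l rho ->
  0 <= l -> 0 < a -> inflection psi Z l <= a -> a < b -> slope psi l a < slope psi l b.
Proof.
move=> rhoP l0 a0 ma ab; rewrite lt_neqAle slope_nondecreasing// ?ltW// andbT.
apply/eqP => E; move: (ab).
have b0 := lt_trans a0 ab; have mb := le_trans ma (ltW ab).
by rewrite -(rho_slope rhoP l0 a0 ma) E (rho_slope rhoP l0 b0 mb) ltxx.
Qed.

(** Exchange argument: adding the two optimality inequalities cancels [psi] and leaves
    [(y' - y) * (rho y' - rho y) >= 0]. *)
Lemma rho_nondecreasing (l : R) (rho : R -> R) (y y' : R) : is_rho_plus psi Z l rho ->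
  (tau psi Z l <= y%:E)%E -> y <= y' -> rho y <= rho y'.
Proof.
move=> rhoP ty; rewrite le_eqVlt => /predU1P[->//|yy'].
have ty' : (tau psi Z l <= y'%:E)%E by rewrite (le_trans ty)// lee_fin ltW.
have [] : minimizers `[inflection psi Z l, +oo[ (scalar_objective psi y l) (rho y).
  by rewrite rhoP.
move=> my /(_ (rho y')) h1.
have [] : minimizers `[inflection psi Z l, +oo[ (scalar_objective psi y' l) (rho y').
  by rewrite rhoP.
move=> my' /(_ _ my) h2; have {}h1 := h1 my'.
rewrite -subr_ge0 -(pmulr_rge0 _ (_ : 0 < y' - y)) ?subr_gt0//.
move: h1 h2; rewrite /scalar_objective; move: (psi _) (psi _) => p q.
move: (rho y) (rho y') => a b; nra.
Qed.

(** The sum is differentiated at [t = 0] along the direction [b]; positive base points avoid 0,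
    where [psi] may have infinite slope. *)
Lemma sum_objective_first_order n (y l a b : 'I_n -> R) (d : R) :
  (forall k, 0 < a k) -> 0 < d ->
  (forall t : R, 0 < t < d -> \sum_k scalar_objective psi (y k) (l k) (a k) <=
     \sum_k scalar_objective psi (y k) (l k) (a k + t * b k)) ->
  0 <= \sum_k b k * (slope psi (l k) (a k) - y k).
Proof.
move=> a0 d0 hmin.
pose f : R -> R := \sum_k (scalar_objective psi (y k) (l k) \o (fun t : R => a k + t * b k)).
have fE t : f t = \sum_k scalar_objective psi (y k) (l k) (a k + t * b k).
  by rewrite /f fct_sumE.
have fD : is_derive (0 : R) 1 f (\sum_k b k * (slope psi (l k) (a k) - y k)).
  apply: is_derive_sum => k.
  have dk : is_derive (0 : R) 1 (fun t : R => a k + t * b k) (b k).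
    have -> : (fun t : R => a k + t * b k) = cst (a k) + b k *: id.
      by apply/funext => t; rewrite mulrC.
    apply: (is_derive_eq (is_deriveD (is_derive_cst (a k) (0 : R) (1 : R))
      (is_deriveZ (b k) (is_derive_id (0 : R) (1 : R))))).
    by rewrite add0r; exact: mulr1.
  rewrite mulrC; apply: (is_derive1_comp _ dk).
  by rewrite mul0r addr0; exact: is_derive_objective.
apply: (derive_ge0_right_min fD d0) => t ht; rewrite !fE.
apply: le_trans (hmin _ ht).
by under eq_bigr do rewrite mul0r addr0.
Qed.

Lemma objective_first_order (y l c b d : R) : 0 < c -> 0 < d ->
  (forall t : R, 0 < t < d ->
     scalar_objective psi y l c <= scalar_objective psi y l (c + t * b)) ->
  0 <= b * (slope psi l c - y).
Proof.
move=> c0 d0 h.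
suff : 0 <= \sum_(k < 1) b * (slope psi l c - y) by rewrite big_ord1.
apply: (@sum_objective_first_order 1 (fun=> y) (fun=> l) (fun=> c) (fun=> b) d) => // t ht.
by rewrite !big_ord1; exact: h.
Qed.

(** Moves to both sides give stationarity. Below the inflection point the slope would strictly
    decrease to the right of [c], and so would the objective. *)
Lemma objective_interior_min (y l c u : R) : 0 <= l -> 0 < c -> c < u ->
  (forall z : R, 0 <= z < u -> scalar_objective psi y l c <= scalar_objective psi y l z) ->
  slope psi l c = y /\ inflection psi Z l <= c.
Proof.
move=> l0 c0 cu hmin.
have cy : slope psi l c = y.
  apply/eqP; rewrite eq_le; apply/andP; split.
    rewrite -subr_ge0 -opprB -mulN1r.
    apply: (@objective_first_order _ _ _ _ c) => // t /andP[t0 tc].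
    by apply: hmin; apply/andP; split; lra.
  rewrite -subr_ge0 -[_ - _]mul1r.
  apply: (@objective_first_order _ _ _ _ (u - c)) => // [|t /andP[t0 tc]]; first by lra.
  by apply: hmin; apply/andP; split; lra.
split=> //; rewrite leNgt; apply/negP => cm.
(* The midpoint is both an allowed competitor, being below [u], and in the concave region. *)
pose w := (c + Num.min u (inflection psi Z l)) / 2.
have [cw [wu wm]] : c < w /\ w < u /\ w < inflection psi Z l.
  by rewrite /w; case: (leP u (inflection psi Z l)) => h; lra.
have /(_ w) := hmin; rewrite wu (ltW (lt_trans c0 cw)) => /(_ isT).
apply/negP; rewrite -ltNge.
have d z : z \in `]c, w[ -> derivable (scalar_objective psi y l) z 1.
  rewrite in_itv/= => /andP[cz _].
  by have dz := is_derive_objective y l (lt_trans c0 cz); exact: ex_derive.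
apply: (ltr0_derive1_lt_cc d) (cw).
- move=> z; rewrite in_itv/= => /andP[cz zw].
  have dz := is_derive_objective y l (lt_trans c0 cz).
  rewrite derive1E derive_val subr_lt0 -cy.
  by apply: slope_decreasing => //; rewrite ltW// (lt_trans zw).
- by apply: continuous_objective; exact: ltW.
- by rewrite bound_itvE ltW.
- by rewrite bound_itvE ltW.
Qed.

End scalar.

(** * Vectors in coordinates: prefixes, padding and local solutions *)

(** Prefixes of every length are handled as functions on all of ['I_p], so that no change of index
    type is needed. *)
Definition cone_below (R : realType) (p m : nat) (v : 'I_p -> R) : Prop :=
  (forall a b : 'I_p, (a <= b)%N -> (b < m)%N -> v b <= v a) /\
  (forall a : 'I_p, (a < m)%N -> 0 <= v a).

Section vectors.
Context (R : realType) (psi : R -> R) (p : nat) (lam y : 'rV[R]_p).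

Local Notation cost k z := (scalar_objective psi (y 0 k) (lam 0 k) z).

Lemma objectiveE (x : 'rV[R]_p) : objective psi lam y x = \sum_k cost k (x 0 k).
Proof. by rewrite /objective mulr_sumr -big_split. Qed.

Lemma monotone_coneE (x : 'rV[R]_p) : monotone_cone x <-> cone_below p (x 0).
Proof.
split=> -[h1 h2]; split.
- by move=> a b ab _; exact: h1.
- by move=> a _; exact: h2.
- by move=> a b ab; apply: h1.
- by move=> a; apply: h2.
Qed.

Lemma monotone_cone_row (v : 'I_p -> R) : cone_below p v -> monotone_cone (\row_k v k).
Proof.
move=> [h1 h2]; apply/monotone_coneE; split=> [a b ab bp|a ap]; rewrite !mxE.
  exact: h1.
exact: h2.
Qed.

Lemma objective_row (v : 'I_p -> R) : objective psi lam y (\row_k v k) = \sum_k cost k (v k).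
Proof. by rewrite objectiveE; apply: eq_bigr => k _; rewrite mxE. Qed.

Lemma objective_before (i : 'I_p) (v : 'rV[R]_p) :
  objective psi (before i lam) (before i y) (before i v) =
  \sum_(k < p | (k < i)%N) cost k (v 0 k).
Proof.
rewrite (big_ord_narrow (ltnW (ltn_ord i))) /objective mulr_sumr -big_split.
by apply: eq_bigr => k _; rewrite !mxE.
Qed.

Lemma cone_before (i : 'I_p) (v : 'rV[R]_p) :
  monotone_cone (before i v) <-> cone_below i (v 0).
Proof.
split=> -[h1 h2]; split.
- move=> a b ab bi; have := h1 (Ordinal (leq_ltn_trans ab bi)) (Ordinal bi) ab.
  by rewrite !mxE; congr (v 0 _ <= v 0 _); exact: val_inj.
- move=> a ai; have := h2 (Ordinal ai).
  by rewrite !mxE; congr (0 <= v 0 _); exact: val_inj.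
- by move=> a b ab; rewrite !mxE; apply: h1 => //=.
- by move=> a; rewrite !mxE; apply: h2 => /=.
Qed.

Lemma before_pad (i : 'I_p) (u : 'rV[R]_i) (c : R) : before i (pad p u c) = u.
Proof.
apply/rowP => k; rewrite !mxE; case: insubP => [j _ jk|]; last by rewrite /= ltn_ord.
by congr (u 0 _); exact: val_inj.
Qed.

Lemma pad_ge (m : nat) (u : 'rV[R]_m) (c : R) (k : 'I_p) :
  (m <= k)%N -> pad p u c 0 k = c.
Proof. by move=> mk; rewrite mxE insubF// ltnNge mk. Qed.

Lemma pad_before (i : 'I_p) (v : 'rV[R]_p) (c : R) :
  (forall k : 'I_p, (i <= k)%N -> v 0 k = c) -> pad p (before i v) c = v.
Proof.
move=> h; apply/rowP => k; have [ki|ik] := ltnP k i; last by rewrite pad_ge// h.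
rewrite !mxE; case: insubP => [j _ jk|]; last by rewrite ki.
by rewrite mxE; congr (v 0 _); exact: val_inj.
Qed.

(** Replaces the neighbourhood filter on row vectors of length [i] by an explicit coordinatewise
    radius, with all indices in ['I_p]. *)
Lemma local_solutions_beforeE (i : 'I_p) (v : 'rV[R]_p) :
  local_solutions_before psi lam y (before i v) <->
  cone_below i (v 0) /\ exists2 e : R, 0 < e & forall w : 'I_p -> R, cone_below i w ->
    (forall k : 'I_p, (k < i)%N -> `|w k - v 0 k| < e) ->
    \sum_(k < p | (k < i)%N) cost k (v 0 k) <= \sum_(k < p | (k < i)%N) cost k (w k).
Proof.
rewrite /local_solutions_before /local_minimizers /= cone_before.
split=> -[cv hv]; split=> //.
  move: hv; rewrite near_withinE => /nbhs_ballP[e /= e0 he]; exists e => // w cw we.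
  have := he (before i (\row_k w k)); rewrite !objective_before cone_before => h.
  have E : \sum_(k < p | (k < i)%N) cost k ((\row_k w k) 0 k) =
           \sum_(k < p | (k < i)%N) cost k (w k).
    by apply: eq_bigr => k _; rewrite mxE.
  rewrite -E; apply: h.
    split=> // a k; rewrite /ball/= !mxE distrC.
    by apply: we => /=.
  by case: cw => h1 h2; split=> [a b|a]; rewrite !mxE; [exact: h1|exact: h2].
case: hv => e e0 he; rewrite near_withinE; apply/nbhs_ballP; exists e => //= w [_ we] cw.
rewrite -(before_pad w 0) !objective_before; apply: he.
  by apply/cone_before; rewrite before_pad.
move=> k ki; have := we 0 (Ordinal ki).
rewrite /ball/= distrC -{1}(before_pad w 0) !mxE.
by congr (`| _ - _ | < e); congr (_ 0 _); exact: val_inj.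
Qed.

End vectors.

(** The smallest excess over [c] among finitely many entries is a uniform margin: it bounds how far
    a tail at [c] may rise, or larger entries may drop, without crossing. *)
Lemma exists_gap (R : realType) (I : finType) (x : I -> R) (c : R) :
  exists2 e : R, 0 < e & forall k, c < x k -> c + e <= x k.
Proof.
have [k0 ck0|none] := pickP (fun k => c < x k); last first.
  by exists 1 => // k; rewrite none.
case: (@arg_minP _ _ _ k0 (fun k => c < x k) x ck0) => k ck kmin.
exists (x k - c); first by rewrite subr_gt0.
by move=> j cj; rewrite addrC subrK kmin.
Qed.

Lemma ler_sum_restrict (R : numDomainType) (I : finType) (P : pred I) (F G : I -> R) :
  (forall k, ~~ P k -> F k = G k) ->
  (\sum_k F k <= \sum_k G k) = (\sum_(k | P k) F k <= \sum_(k | P k) G k).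
Proof.
move=> FG; rewrite (bigID P) /= [X in _ <= X](bigID P) /=.
by rewrite [X in _ + X <= _](eq_bigr _ FG) lerD2r.
Qed.

(** * Means over blocks and the averaged scalar problem *)

Section means.
Context (R : realType) (p : nat).

Lemma mem_block_last (i k : 'I_p) : (k \in block p i p.-1) = (i <= k)%N.
Proof.
have p0 : (0 < p)%N := leq_ltn_trans (leq0n k) (ltn_ord k).
by rewrite inE -[(k <= p.-1)%N]ltnS (prednK p0) ltn_ord andbT.
Qed.

Lemma mean_ge0 (v : 'rV[R]_p) (B : {set 'I_p}) : (forall k, 0 <= v 0 k) -> 0 <= mean v B.
Proof.
by move=> v0; rewrite mulr_ge0 ?invr_ge0 ?ler0n//; apply: sumr_ge0.
Qed.

Lemma mean_singleton (v : 'rV[R]_p) (i : 'I_p) : mean v (block p i i) = v 0 i.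
Proof.
have -> : block p i i = [set i]%SET.
  by apply/setP => k; rewrite !inE -eqn_leq -val_eqE eq_sym.
by rewrite /mean cards1 big_set1 invr1 mul1r.
Qed.

Lemma mean_le (v : 'rV[R]_p) (B : {set 'I_p}) (m : R) : 0 < (#|B|%:R : R) ->
  (forall k, k \in B -> v 0 k <= m) -> mean v B <= m.
Proof.
move=> B0 vm; rewrite /mean ler_pdivrMl// mulr_natl -sumr_const.
exact: ler_sum.
Qed.

(** The change of cost from [z] to [w] is affine in the data of each coordinate, so its sum over the
    block is [#|B|] times the change for the means. *)
Lemma objective_block_le (psi : R -> R) (lam y : 'rV[R]_p) (B : {set 'I_p}) (z w : R) :
  0 < (#|B|%:R : R) ->
  \sum_(k in B) scalar_objective psi (y 0 k) (lam 0 k) z <=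
  \sum_(k in B) scalar_objective psi (y 0 k) (lam 0 k) w ->
  scalar_objective psi (mean y B) (mean lam B) z <=
  scalar_objective psi (mean y B) (mean lam B) w.
Proof.
move=> B0; rewrite -subr_ge0 -sumrB => h; rewrite -subr_ge0.
rewrite -(pmulr_rge0 _ B0); apply: le_trans h _; rewrite le_eqVlt; apply/orP; left; apply/eqP.
transitivity (\sum_(k in B) (2^-1 * (w ^+ 2 - z ^+ 2) - (w - z) * y 0 k
   + (psi w - psi z) * lam 0 k)).
  by apply: eq_bigr => k _; rewrite /scalar_objective; field.
rewrite big_split sumrB /= -!mulr_sumr sumr_const -[_ *+ #|B|]mulr_natl.
have E (v : 'rV[R]_p) : \sum_(k in B) v 0 k = #|B|%:R * mean v B.
  by rewrite /mean mulrA divff ?mul1r// gt_eqF.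
by rewrite !E /scalar_objective; field.
Qed.

End means.

(** * Competitors of a global minimizer whose value is [c] exactly from index [i] on *)

Section global_min.
Context (R : realType) (psi : R -> R) (p : nat) (lam y x : 'rV[R]_p).

Local Notation cost k z := (scalar_objective psi (y 0 k) (lam 0 k) z).

Hypothesis x_min : minimizers (@monotone_cone R p) (objective psi lam y) x.

Lemma global_min_le (w : 'I_p -> R) : cone_below p w ->
  \sum_k cost k (x 0 k) <= \sum_k cost k (w k).
Proof.
move=> cw; rewrite -objectiveE -objective_row; apply: x_min.2.
exact: monotone_cone_row.
Qed.

Context (i : 'I_p) (c : R).
Hypothesis c_ge0 : 0 <= c.
Hypothesis x_gt : forall k : 'I_p, (k < i)%N -> c < x 0 k.
Hypothesis x_eq : forall k : 'I_p, (i <= k)%N -> x 0 k = c.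

(** Since [w] stays above [c], extending it by [c] gives a point of the cone that agrees with [x]
    from [j] on. *)
Lemma global_min_prefix_le (j : nat) (w : 'I_p -> R) : (i <= j)%N -> cone_below j w ->
  (forall k : 'I_p, (k < j)%N -> c <= w k) ->
  \sum_(k < p | (k < j)%N) cost k (x 0 k) <= \sum_(k < p | (k < j)%N) cost k (w k).
Proof.
move=> ij [w1 w2] cw; pose w' (k : 'I_p) := if (k < j)%N then w k else c.
have /global_min_le : cone_below p w'.
  split=> [a b ab bp|a ap]; rewrite /w'.
    case: ltnP => bj; first by rewrite (leq_ltn_trans ab bj) w1.
    by case: ltnP => aj //; exact: cw.
  by case: ltnP => aj //; exact: w2.
rewrite (@ler_sum_restrict _ _ (fun k : 'I_p => (k < j)%N)) => [|k]; last first.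
  by rewrite /w' -leqNgt => jk; rewrite ltnNge jk x_eq// (leq_trans ij).
by under [X in _ <= X -> _]eq_bigr => k kj do rewrite /w' kj.
Qed.

(** The competitor replaces the tail of [x] from [j] on by [z]; both tails are constant, so the
    comparison passes to means. *)
Lemma global_min_suffix_le (j : 'I_p) (z : R) : (i <= j)%N -> 0 <= z ->
  (forall k : 'I_p, (k < j)%N -> z <= x 0 k) ->
  scalar_objective psi (mean y (block p j p.-1)) (mean lam (block p j p.-1)) c <=
  scalar_objective psi (mean y (block p j p.-1)) (mean lam (block p j p.-1)) z.
Proof.
move=> ij z0 zx; pose w' (k : 'I_p) := if (k < j)%N then x 0 k else z.
have [/monotone_coneE[x1 x2] _] := x_min.
have B0 : 0 < (#|block p j p.-1|%:R : R).
  by rewrite ltr0n; apply/card_gt0P; exists j; rewrite mem_block_last.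
apply: objective_block_le => //.
have /global_min_le : cone_below p w'.
  split=> [a b ab bp|a ap]; rewrite /w'.
    case: ltnP => bj; first by rewrite (leq_ltn_trans ab bj) x1.
    by case: ltnP => aj //; exact: zx.
  by case: ltnP => aj //; exact: x2.
rewrite (@ler_sum_restrict _ _ [in block p j p.-1]) => [|k]; last first.
  by rewrite /w' mem_block_last -ltnNge => ->.
rewrite (eq_bigr (fun k : 'I_p => cost k c)) => [|k]; last first.
  by rewrite mem_block_last => jk; rewrite x_eq// (leq_trans ij).
rewrite [X in _ <= X -> _](eq_bigr (fun k : 'I_p => cost k z)) => [//|k].
by rewrite mem_block_last /w' ltnNge => ->.
Qed.

(** By the gap, small perturbations of the entries before [i] stay above [c]. *)
Lemma global_min_before : local_solutions_before psi lam y (before i x).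
Proof.
have [/monotone_coneE[x1 x2] _] := x_min.
have [e e0 he] := exists_gap (x 0) c.
apply/local_solutions_beforeE; split.
  by split=> [a b ab bi|a ai]; [exact: x1|exact: x2].
exists e => // w cw we; apply: global_min_prefix_le => // k ki.
have := we k ki; rewrite ltr_norml => /andP[h _].
by have := he k (x_gt ki); lra.
Qed.

(* A perturbation w of x on [0, j[ splits coordinatewise into max(w, c), which extends
   by c to a competitor of x, and min(w, c), which is a competitor of v: each
   coordinate cost of w is the sum of the two, up to the cost of c. *)
Lemma global_min_before_splice (j : 'I_p) (v : 'rV[R]_p) : (i <= j)%N ->
  local_solutions_before psi lam y (before j v) ->
  (forall k : 'I_p, (k < j)%N -> c <= v 0 k) ->
  (forall k : 'I_p, (i <= k < j)%N -> v 0 k = c) ->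
  local_solutions_before psi lam y (before j x).
Proof.
move=> ij /local_solutions_beforeE[[v1 v2] [e2 e20 he2]] cv vc.
have [/monotone_coneE[x1 x2] _] := x_min.
have [e1 e10 he1] := exists_gap (x 0) c.
apply/local_solutions_beforeE; split.
  by split=> [a b ab bi|a ai]; [exact: x1|exact: x2].
exists (Num.min e1 e2) => [|w [w1 w2] we]; first by rewrite lt_min e10.
have cw (k : 'I_p) : (k < i)%N -> c <= w k.
  move=> ki; have := we k (leq_trans ki ij).
  rewrite lt_min => /andP[+ _]; rewrite ltr_norml => /andP[h _].
  by have := he1 k (x_gt ki); lra.
have up := @global_min_prefix_le j (fun k => Num.max (w k) c) ij.
have {up}/up : cone_below j (fun k => Num.max (w k) c).
  split=> [a b ab bj|a aj]; last by rewrite le_max c_ge0 orbT.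
  by rewrite ge_max !le_max w1//= lexx orbT.
have cmax (k : 'I_p) : (k < j)%N -> c <= Num.max (w k) c by rewrite le_max lexx orbT.
move=> /(_ cmax) up.
(* Before [i] the entries of [w] exceed [c], so the maximum accounts for all of [w] and [v] is left
   unchanged there. *)
pose w' (k : 'I_p) := if (k < i)%N then v 0 k else Num.min (w k) c.
have low : \sum_(k < p | (k < j)%N) cost k (v 0 k) <= \sum_(k < p | (k < j)%N) cost k (w' k).
  apply: he2; rewrite /w'.
    split=> [a b ab bj|a aj]; last first.
      by case: ltnP => ai; [exact: v2|rewrite le_min c_ge0 w2].
    case: ltnP => bi; first by rewrite (leq_ltn_trans ab bi) v1.
    case: ltnP => ai; last by rewrite le_min !ge_min w1//= lexx orbT.
    by rewrite ge_min (cv a) ?orbT// (leq_ltn_trans ab).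
  move=> k kj; case: ltnP => ki; first by rewrite subrr normr0.
  have := we k kj; rewrite vc ?ki// x_eq// lt_min => /andP[_].
  case: (leP (w k) c) => // h _; by rewrite subrr normr0.
have -> : \sum_(k < p | (k < j)%N) cost k (w k) =
    \sum_(k < p | (k < j)%N) cost k (Num.max (w k) c) +
    (\sum_(k < p | (k < j)%N) cost k (w' k) - \sum_(k < p | (k < j)%N) cost k (v 0 k)).
  rewrite -sumrB -big_split; apply: eq_bigr => k kj; rewrite /= /w'.
  case: ltnP => ki; first by rewrite (max_idPl (cw k ki)) subrr addr0.
  rewrite vc ?ki//; case: (leP (w k) c) => h; last by rewrite subrr addr0.
  by rewrite addrC subrK.
by lra.
Qed.

(* Move x towards v and v towards x on [i, j[: the first order conditions at the two
   ends of the segment contradict the strict monotonicity of the slopes. *)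
Lemma local_before_rigid (Z : set R) (j : 'I_p) (v : 'rV[R]_p) :
  admissible_penalty psi Z -> 0 < c -> (i <= j)%N ->
  local_solutions_before psi lam y (before j v) ->
  (forall k : 'I_p, (k < j)%N -> c <= v 0 k) ->
  (forall (k : 'I_p) b, (i <= k)%N -> c < b ->
    slope psi (lam 0 k) c < slope psi (lam 0 k) b) ->
  forall k : 'I_p, (i <= k < j)%N -> v 0 k = c.
Proof.
move=> psi_adm c0 ij /local_solutions_beforeE[[v1 v2] [e2 e20 he2]] cv hs.
have [/monotone_coneE[x1 x2] _] := x_min.
have [e1 e10 he1] := exists_gap (x 0) c.
pose b (k : 'I_p) := if (i <= k < j)%N then v 0 k - c else 0.
have b0 k : 0 <= b k.
  by rewrite /b; case: ifP => // /andP[_ kj]; rewrite subr_ge0 cv.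
(* Steps shorter than [e / (1 + M)] move every coordinate by less than [e]; the summand 1 avoids a
   division by 0. *)
pose M := \sum_k b k.
have bM k : b k <= M.
  by rewrite /M (bigD1 k)//= lerDl sumr_ge0.
have M0 : 0 <= M by exact: sumr_ge0.
have M1 : 0 < 1 + M by lra.
have bound (e t : R) k : 0 < e -> 0 < t < e / (1 + M) -> t * b k < e.
  move=> e0 /andP[t0]; rewrite ltr_pdivlMr// => ht.
  by have := bM k; nra.
have bmono (k l : 'I_p) : (i <= k)%N -> (k <= l)%N -> b l <= b k.
  move=> ik kl; rewrite {1}/b; case: ifP => // /andP[il lj].
  by rewrite /b ik (leq_ltn_trans kl lj) lerD2r v1.
have blow (k : 'I_p) : (k < i)%N -> b k = 0 by move=> ki; rewrite /b leqNgt ki.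
have bhigh (k : 'I_p) : (j <= k)%N -> b k = 0 by move=> ki; rewrite /b ltnNge ki andbF.
(* The filler [c] keeps all base points positive; from [j] on the direction [b] vanishes. *)
pose a (k : 'I_p) := if (k < j)%N then v 0 k else c.
have a0 k : 0 < a k.
  by rewrite /a; case: ifP => // kj; exact: lt_le_trans c0 (cv k kj).
have xc k : c <= x 0 k.
  by case: (ltnP k i) => [/x_gt/ltW//|/x_eq ->].
have H1 : 0 <= \sum_k b k * (slope psi (lam 0 k) (x 0 k) - y 0 k).
  apply: (sum_objective_first_order psi_adm (d := e1 / (1 + M))).
  - by move=> k; exact: lt_le_trans c0 (xc k).
  - exact: divr_gt0.
  - move=> t ht; have t0 : 0 < t by case/andP: ht.
    apply: global_min_le; split=> [k l kl _|k _]; last first.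
      by rewrite addr_ge0 ?x2 ?mulr_ge0// ltW.
    case: (ltnP k i) => ki.
      rewrite (blow k ki) mulr0 addr0.
      case: (ltnP l i) => li; first by rewrite (blow l li) mulr0 addr0 x1.
      rewrite x_eq//; apply: le_trans (he1 k (x_gt ki)).
      by rewrite lerD2l ltW// bound.
    rewrite !x_eq ?(leq_trans ki)// lerD2l ler_pM2l//.
    exact: bmono.
(* The bound 1 on the step keeps the moved entries of [v] above [c] and in order. *)
have H2 : 0 <= \sum_k (- b k) * (slope psi (lam 0 k) (a k) - y 0 k).
  apply: (sum_objective_first_order psi_adm (d := Num.min 1 (e2 / (1 + M)))) => //.
    by rewrite lt_min ltr01 divr_gt0.
  move=> t /andP[t0]; rewrite lt_min => /andP[t1 te].
  rewrite (@ler_sum_restrict _ _ (fun k : 'I_p => (k < j)%N)) => [|k]; last first.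
    by rewrite -leqNgt => jk; rewrite bhigh// oppr0 mulr0 addr0.
  rewrite (eq_bigr (fun k : 'I_p => cost k (v 0 k))) => [|k kj]; last by rewrite /a kj.
  rewrite [X in _ <= X](eq_bigr (fun k : 'I_p => cost k (v 0 k - t * b k))) => [|k kj]; last first.
    by rewrite /a kj mulrN.
  apply: he2.
    have vtb (k : 'I_p) : (k < j)%N -> c <= v 0 k - t * b k.
      move=> kj; have := cv k kj; rewrite /b; case: ifP => _ h; last by rewrite mulr0 subr0.
      nra.
    split=> [k l kl lj|k kj]; last exact: le_trans c_ge0 (vtb k kj).
    have kj := leq_ltn_trans kl lj; have vkl := v1 k l kl lj.
    case: (ltnP k i) => ki.
      rewrite (blow k ki) mulr0 subr0; apply: le_trans vkl.
      by rewrite gerBl mulr_ge0// ltW.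
    rewrite /b ki kj (leq_trans ki kl) lj /=; nra.
  move=> k kj; rewrite addrAC subrr add0r normrN ger0_norm ?mulr_ge0// ?ltW//.
  by apply: bound => //; rewrite t0.
have Hk k : 0 <= b k * (slope psi (lam 0 k) (a k) - slope psi (lam 0 k) (x 0 k)).
  rewrite /b; case: ifP => [/andP[ik kj]|_]; last by rewrite mul0r.
  rewrite /a kj x_eq//; have := cv k kj; rewrite le_eqVlt => /predU1P[->|h].
    by rewrite !subrr mul0r.
  by rewrite mulr_ge0// subr_ge0 ltW// hs.
(* This sum is minus the sum of the two first-order expressions, hence at most 0, while its terms
   are nonnegative; so each term vanishes. *)
have /eqP : \sum_k b k * (slope psi (lam 0 k) (a k) - slope psi (lam 0 k) (x 0 k)) = 0.
  apply/eqP; rewrite eq_le sumr_ge0// andbT -oppr_ge0.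
  have -> : - \sum_k b k * (slope psi (lam 0 k) (a k) - slope psi (lam 0 k) (x 0 k)) =
    \sum_k b k * (slope psi (lam 0 k) (x 0 k) - y 0 k) +
    \sum_k (- b k) * (slope psi (lam 0 k) (a k) - y 0 k).
    by rewrite -sumrN -big_split; apply: eq_bigr => k _; rewrite /=; ring.
  exact: addr_ge0.
rewrite psumr_eq0// => /allP h k /andP[ik kj].
have := h k (mem_index_enum k); rewrite /= /b ik kj /a kj x_eq// mulf_eq0 !subr_eq0.
have := cv k kj; rewrite le_eqVlt => /predU1P[//|cvk].
by rewrite (gt_eqF cvk) (gt_eqF (hs k _ ik cvk)).
Qed.

End global_min.

(** * Comparison of the start of the last constant block with [istar] *)

Theorem mainTheorem3 (R : realType) (psi : R -> R) (Z : set R)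
    (psi_adm : admissible_penalty psi Z)
    (p : nat) (lam y : 'rV[R]_p)
    (lam_mono : monotone_cone lam)
    (lam_strict :
      (exists i j : 'I_p, j = i.+1 :> nat /\ lam 0 j < lam 0 i) \/
      (exists i : 'I_p, i.+1 = p /\ 0 < lam 0 i))
    (y_mono : monotone_cone y)
    (rho : R -> R -> R) (T : R -> R)
    (rhoP : forall q r : 'I_p, (q <= r)%N ->
      is_rho_plus psi Z (mean lam (block p q r))
        (fun t => rho t (mean lam (block p q r))))
    (TP : forall q r : 'I_p, (q <= r)%N ->
      is_threshold psi Z (mean lam (block p q r))
        (fun t => rho t (mean lam (block p q r))) (T (mean lam (block p q r))))
    (prefix_cond : forall q r' r : 'I_p, (q <= r')%N -> (r' <= r)%N ->
      inflection psi Z (mean lam (block p q r'))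
      <= rho (T (mean lam (block p q r))) (mean lam (block p q r)))
    (istar : 'I_p)
    (istar_start : feasible_start psi Z rho lam y istar)
    (istar_max : forall i : 'I_p, feasible_start psi Z rho lam y i ->
      (i <= istar)%N)
    (x : 'rV[R]_p)
    (x_min : minimizers (@monotone_cone R p) (objective psi lam y) x) :
  (exists2 u : 'rV[R]_istar, local_solutions_before psi lam y u &
     x = pad p u (chi psi Z rho lam y (block p istar p.-1))) \/
  (exists i : 'I_p, exists2 u : 'rV[R]_i, local_solutions_before psi lam y u &
     x = pad p u 0).
Proof.
have p_lt : (p.-1 < p)%N by rewrite prednK// (leq_ltn_trans _ (ltn_ord istar)).
pose last_idx := Ordinal p_lt.
have le_last (k : 'I_p) : (k <= last_idx)%N.
  by rewrite -ltnS /= prednK// (leq_ltn_trans _ (ltn_ord k)).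
have [x_cone _] := x_min; have [x_noninc x_ge0] := x_cone.
have [lam_noninc lam_ge0] := lam_mono.
set c := x 0 last_idx.
have [i /eqP xi i_first] := @arg_minnP _ last_idx (fun k => x 0 k == c) (@nat_of_ord p) (eqxx c).
have x_eq (k : 'I_p) : (i <= k)%N -> x 0 k = c.
  move=> ik; apply/eqP; rewrite eq_le -{1}xi x_noninc//=.
  exact: x_noninc.
have x_gt (k : 'I_p) : (k < i)%N -> c < x 0 k.
  move=> ki; rewrite lt_neqAle -{2}xi x_noninc ?(ltnW ki)// andbT.
  by apply: contraTneq ki => ck; rewrite -leqNgt i_first// -ck.
have c_ge0 : 0 <= c by exact: x_ge0.
have x_before := global_min_before x_min c_ge0 x_gt x_eq.
have mean_lam_ge0 B : 0 <= mean lam B by exact: mean_ge0.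
move: (c_ge0); rewrite le_eqVlt => /predU1P[c_eq0|c_gt0].
  by right; exists i, (before i x); rewrite // pad_before// c_eq0.
left.
pose lamB := mean lam (block p i p.-1); pose yB := mean y (block p i p.-1).
have lamB_ge0 : 0 <= lamB by exact: mean_lam_ge0.
have [e e_gt0 gap] := exists_gap (x 0) c.
have min_B (z : R) : 0 <= z -> z < c + e ->
    scalar_objective psi yB lamB c <= scalar_objective psi yB lamB z.
  move=> z_ge0 zce; apply: (global_min_suffix_le x_min x_eq) => // k ki.
  exact: le_trans (ltW zce) (gap k (x_gt k ki)).
have [slope_B infl_B] : slope psi lamB c = yB /\ inflection psi Z lamB <= c.
  have c_lt : c < c + e by rewrite ltrDl.
  apply: (objective_interior_min psi_adm (mean_lam_ge0 _) c_gt0 c_lt).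
  by move=> z /andP[]; exact: min_B.
have rhoB := rhoP i last_idx (le_last i).
have tauB : (tau psi Z lamB <= yB%:E)%E.
  by rewrite -slope_B; apply: (tau_le_slope psi_adm).
have rho_B : rho yB lamB = c by rewrite -slope_B (rho_slope psi_adm rhoB).
have [tauT thr] := TP i last_idx (le_last i).
(* Below the threshold 0 is the only global minimizer, yet [c] does at least as well as 0 by
   [min_B]. *)
have T_le : T lamB <= yB.
  rewrite leNgt; apply/negP => yT; have [/(_ yT) zmin _ _] := thr yB.
  have [_ min0] : minimizers `[0, +oo[ (scalar_objective psi yB lamB) 0 by rewrite zmin.
  have : minimizers `[0, +oo[ (scalar_objective psi yB lamB) c.
    split=> [|w w0]; first by rewrite /= in_itv/= c_ge0.
    by apply: le_trans (min0 w w0); apply: min_B => //; rewrite addr_gt0.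
  by rewrite zmin => /= c0; move: c_gt0; rewrite c0 ltxx.
have infl_i : inflection psi Z (lam 0 i) <= c.
  rewrite -(mean_singleton lam i); apply: le_trans (prefix_cond i i last_idx _ (le_last i)) _ => //.
  by rewrite -rho_B; apply: (rho_nondecreasing rhoB).
have infl_le l : 0 <= l -> l <= lam 0 i -> inflection psi Z l <= c.
  by move=> l0 li; apply: le_trans infl_i; apply: (le_inflection psi_adm).
have chi_B : chi psi Z rho lam y (block p i p.-1) = c by rewrite /chi ifT.
have i_start : feasible_start psi Z rho lam y i.
  by exists (before i x); rewrite // chi_B pad_before.
move: (istar_max i i_start); rewrite leq_eqVlt => /predU1P[/val_inj <-|i_lt].
  by exists (before i x); rewrite // chi_B pad_before.
have [u u_local v_cone] := istar_start.
set d := chi psi Z rho lam y (block p istar p.-1) in v_cone *.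
pose lamS := mean lam (block p istar p.-1); pose yS := mean y (block p istar p.-1).
have lamS_ge0 : 0 <= lamS by exact: mean_lam_ge0.
have i_le := ltnW i_lt.
have infl_S : inflection psi Z lamS <= c.
  apply: infl_le => //; apply: mean_le => [|k].
    by rewrite ltr0n; apply/card_gt0P; exists istar; rewrite mem_block_last.
  by rewrite mem_block_last => jk; apply: lam_noninc; exact: leq_trans jk.
(* The entries just before [istar] also equal [c], so the tail can only be lowered: direction -1,
   and one inequality. *)
have slope_S : slope psi lamS c <= yS.
  rewrite -subr_ge0 -opprB -mulN1r.
  apply: (objective_first_order psi_adm c_gt0 c_gt0) => t /andP[t_gt0 tc].
  apply: (global_min_suffix_le x_min x_eq) => //; first by lra.
  move=> k kj; apply: (@le_trans _ _ c); first by lra.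
  by have [/x_gt/ltW//|/x_eq ->] := ltnP k i.
have tauS : (tau psi Z lamS <= yS%:E)%E.
  by apply: (@le_trans _ _ (slope psi lamS c)%:E); rewrite ?lee_fin// (tau_le_slope psi_adm).
have rhoS := rhoP istar last_idx (le_last istar) yS tauS.
have d_rho : d = rho yS lamS by rewrite /d /chi ifT.
(* If [d < c], the slope bound makes [c] as good as [d] on the convex region, against uniqueness. *)
have c_le_d : c <= d.
  rewrite leNgt; apply/negP => dc.
  have [infl_d min_d] : minimizers `[inflection psi Z lamS, +oo[ (scalar_objective psi yS lamS) d.
    by rewrite rhoS d_rho.
  have : minimizers `[inflection psi Z lamS, +oo[ (scalar_objective psi yS lamS) c.
    split=> [|w w_in]; first by rewrite /= in_itv/= infl_S.
    apply: le_trans (min_d w w_in); apply: (objective_le_left psi_adm) => //; last exact: ltW.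
    by move: infl_d; rewrite /= in_itv/= andbT.
  by rewrite rhoS -d_rho => /= cd; move: dc; rewrite cd ltxx.
pose v := pad p u d.
have v_last : v 0 last_idx = d by rewrite /v pad_ge.
have v_ge (k : 'I_p) : c <= v 0 k.
  by apply: le_trans c_le_d _; rewrite -v_last; apply: v_cone.1.
have v_local : local_solutions_before psi lam y (before istar v) by rewrite before_pad.
have v_eq : forall k : 'I_p, (i <= k < istar)%N -> v 0 k = c.
  apply: (local_before_rigid x_min c_ge0 x_gt x_eq psi_adm) => // k b ik cb.
  (* A one-element block has mean [lam 0 k], which gives strictness for each single weight. *)
  have := rhoP k k (leqnn k); rewrite mean_singleton => rho_k.
  by apply: (slope_increasing psi_adm rho_k) => //; apply: infl_le => //; exact: lam_noninc.
(* As [i < istar], the entry of [v] at [i] is [c], and it dominates the last entry [d]. *)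
have d_eq : d = c.
  apply/eqP; rewrite eq_le c_le_d andbT -v_last -(v_eq i) ?leqnn//.
  exact: v_cone.1.
exists (before istar x).
  by apply: (global_min_before_splice x_min c_ge0 x_gt x_eq i_le v_local).
by rewrite d_eq pad_before// => k jk; rewrite x_eq// (leq_trans i_le).
Qed.
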